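(* Let $ABC$ be a nondegenerate triangle in the Euclidean plane and let $P$ be any point in its interior. Let lines $AP$, $BP$, $CP$ meet the sides $BC$, $CA$, $AB$ at $D$, $E$, $F$, respectively, so that the cevians $AD$, $BE$, $CF$ divide $\triangle ABC$ into the six triangles $T_1=PBD$, $T_2=PDC$, $T_3=PCE$, $T_4=PEA$, $T_5=PAF$, $T_6=PFB$. Let $R_i$ be the circumradius of $T_i$ for $i=1,\dots,6$. Then $$R_1R_3R_5=R_2R_4R_6.$$
   Context: A cevian through $P$ is a segment from a vertex of the triangle through $P$ to the opposite side. *)

(* Defs.v *)
From Stdlib Require Import Reals ClassicalEpsilon.
Open Scope R_scope.

Definition point : Type := (R * R)%type.

Definition dist (X Y : point) : R :=
  dist_euc (fst X) (snd X) (fst Y) (snd Y).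

(** [(1 - t) X + t Y] *)
Definition affine (t : R) (X Y : point) : point :=
  ((1 - t) * fst X + t * fst Y, (1 - t) * snd X + t * snd Y).

(** The line through [X] and [Y]; it is the single point [X] when [X = Y]. *)
Definition on_line (X Y Z : point) : Prop :=
  exists t : R, Z = affine t X Y.

Definition on_segment (X Y Z : point) : Prop :=
  exists t : R, 0 <= t <= 1 /\ Z = affine t X Y.

Definition collinear (X Y Z : point) : Prop :=
  exists U V : point, on_line U V X /\ on_line U V Y /\ on_line U V Z.

Definition nondegenerate (A B C : point) : Prop := ~ collinear A B C.

(** All three barycentric coordinates are positive. *)
Definition in_interior (A B C P : point) : Prop :=
  exists a b c : R,
    0 < a /\ 0 < b /\ 0 < c /\ a + b + c = 1 /\
    P = (a * fst A + b * fst B + c * fst C,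
         a * snd A + b * snd B + c * snd C).

Definition is_circumcircle (O : point) (r : R) (X Y Z : point) : Prop :=
  dist O X = r /\ dist O Y = r /\ dist O Z = r.

(** The radius of the circle through [X], [Y], [Z], which exists and is unique
    when they are not collinear; the value is meaningless otherwise. *)
Definition circumradius (X Y Z : point) : R :=
  epsilon (inhabits 0) (fun r => exists O : point, is_circumcircle O r X Y Z).

(* Main.v *)
(** By the law of sines, [R_1 = PB / (2 sin PDB)] and [R_2 = PC / (2 sin PDC)]. The
    angles at [D] are supplementary, so [R_1 * PC = R_2 * PB]. Multiplying the three
    cyclic versions of this identity and cancelling [PA * PB * PC] gives the claim.
    The sines are avoided by using the formula [R = XY * YZ * ZX / (2 |det|)], where
    [|det|] is twice the area of [XYZ]. *)

Require Import Defs.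
From Stdlib Require Import Reals.
From Stdlib Require Import Lra ClassicalEpsilon.
(* [Reals] also has a [dist], the projection of [Metric_Space]; this makes [dist]
   refer to the planar one again. *)
Import Defs.
Open Scope R_scope.

Definition det (X Y Z : point) : R :=
  (fst Y - fst X) * (snd Z - snd X) - (snd Y - snd X) * (fst Z - fst X).

Lemma dist_nonneg (X Y : point) : 0 <= dist X Y.
Proof. apply sqrt_pos. Qed.

Lemma dist_sqr (X Y : point) :
  (dist X Y)² = (fst X - fst Y)² + (snd X - snd Y)².
Proof.
  unfold dist, dist_euc. apply Rsqr_sqrt.
  apply Rplus_le_le_0_compat; apply Rle_0_sqr.
Qed.

Lemma dist_sym (X Y : point) : dist X Y = dist Y X.
Proof. apply distance_symm. Qed.

Lemma dist_affine_l (t : R) (X Y : point) :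
  dist X (affine t X Y) = Rabs t * dist X Y.
Proof.
  apply Rsqr_inj.
  - apply dist_nonneg.
  - apply Rmult_le_pos; [apply Rabs_pos | apply dist_nonneg].
  - rewrite Rsqr_mult, <- Rsqr_abs, !dist_sqr. unfold affine, Rsqr; simpl. ring.
Qed.

Lemma dist_affine_r (t : R) (X Y : point) :
  dist (affine t X Y) Y = Rabs (1 - t) * dist X Y.
Proof.
  apply Rsqr_inj.
  - apply dist_nonneg.
  - apply Rmult_le_pos; [apply Rabs_pos | apply dist_nonneg].
  - rewrite Rsqr_mult, <- Rsqr_abs, !dist_sqr. unfold affine, Rsqr; simpl. ring.
Qed.

Lemma dist_neq_0_of_det (X Y Z : point) : det X Y Z <> 0 -> dist X Y <> 0.
Proof.
  intros Hdet H0. apply Hdet.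
  pose proof (dist_sqr X Y) as H. rewrite H0, Rsqr_0 in H.
  destruct (Rplus_sqr_eq_0 _ _ (eq_sym H)) as [Hx Hy].
  unfold det.
  replace (fst Y - fst X) with 0 by lra.
  replace (snd Y - snd X) with 0 by lra.
  ring.
Qed.

Lemma det_nondegenerate (A B C : point) : nondegenerate A B C -> det A B C <> 0.
Proof.
  destruct A as [a1 a2], B as [b1 b2], C as [c1 c2].
  intros H Hdet. apply H. unfold det in Hdet; simpl in Hdet.
  assert (HA : forall V, on_line (a1, a2) V (a1, a2)).
  { intros [v1 v2]. exists 0. unfold affine; simpl. f_equal; ring. }
  assert (Hend : forall V, on_line (a1, a2) V V).
  { intros [v1 v2]. exists 1. unfold affine; simpl. f_equal; ring. }
  (* If [A = B], the line from [A] to [C] serves. Otherwise the line from [A] to [B] does, and the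
     parameter of [C] is read off a coordinate in which [A] and [B] differ. *)
  destruct (Req_dec b1 a1) as [E1|N1]; [destruct (Req_dec b2 a2) as [E2|N2]|].
  - subst. exists (a1, a2), (c1, c2). auto.
  - exists (a1, a2), (b1, b2). repeat split; auto.
    exists ((c2 - a2) / (b2 - a2)). unfold affine; simpl.
    assert (b2 - a2 <> 0) by lra. subst b1.
    assert (E : c1 = a1) by (apply (Rmult_eq_reg_l (b2 - a2)); lra).
    subst c1. f_equal; field; assumption.
  - exists (a1, a2), (b1, b2). repeat split; auto.
    exists ((c1 - a1) / (b1 - a1)). unfold affine; simpl.
    assert (b1 - a1 <> 0) by lra.
    f_equal; [field; assumption|].
    apply (Rmult_eq_reg_l (b1 - a1)); [|assumption].
    field_simplify; [lra | assumption].
Qed.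

(** With [X] as origin, the perpendicular bisectors of [XY] and [XZ] are two linear equations for
    [O]. They determine [2 * det X Y Z] times the vector [O - X], and its squared length factors
    into the three squared sides. *)
Lemma circumcircle_radius (O X Y Z : point) (r : R) :
  is_circumcircle O r X Y Z ->
  2 * Rabs (det X Y Z) * r = dist X Y * dist Y Z * dist Z X.
Proof.
  intros [HX [HY HZ]].
  assert (Hr : 0 <= r) by (rewrite <- HX; apply dist_nonneg).
  pose proof (dist_sqr O X) as SX. pose proof (dist_sqr O Y) as SY.
  pose proof (dist_sqr O Z) as SZ.
  rewrite HX in SX. rewrite HY in SY. rewrite HZ in SZ.
  apply Rsqr_inj.
  - pose proof (Rabs_pos (det X Y Z)). apply Rmult_le_pos; lra.
  - repeat apply Rmult_le_pos; apply dist_nonneg.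
  - rewrite !Rsqr_mult, <- Rsqr_abs, SX, !dist_sqr.
    destruct O as [o1 o2], X as [x1 x2], Y as [y1 y2], Z as [z1 z2].
    unfold det, Rsqr in *; simpl in *.
    set (p1 := y1 - x1). set (p2 := y2 - x2).
    set (q1 := z1 - x1). set (q2 := z2 - x2).
    set (u := o1 - x1). set (v := o2 - x2).
    (* [OX = OY] and [OX = OZ] after the quadratic terms in [O] cancel. *)
    assert (Hp : 2 * (u * p1 + v * p2) = p1 * p1 + p2 * p2)
      by (unfold u, v, p1, p2; lra).
    assert (Hq : 2 * (u * q1 + v * q2) = q1 * q1 + q2 * q2)
      by (unfold u, v, q1, q2; lra).
    (* Cramer's rule for the two perpendicular bisectors. *)
    assert (Hu : 2 * (p1 * q2 - p2 * q1) * u =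
                 (p1 * p1 + p2 * p2) * q2 - (q1 * q1 + q2 * q2) * p2)
      by (rewrite <- Hp, <- Hq; ring).
    assert (Hv : 2 * (p1 * q2 - p2 * q1) * v =
                 (q1 * q1 + q2 * q2) * p1 - (p1 * p1 + p2 * p2) * q1)
      by (rewrite <- Hp, <- Hq; ring).
    replace (2 * 2 * ((p1 * q2 - p2 * q1) * (p1 * q2 - p2 * q1)) * (u * u + v * v))
      with ((2 * (p1 * q2 - p2 * q1) * u) * (2 * (p1 * q2 - p2 * q1) * u) +
            (2 * (p1 * q2 - p2 * q1) * v) * (2 * (p1 * q2 - p2 * q1) * v)) by ring.
    rewrite Hu, Hv. unfold p1, p2, q1, q2. ring.
Qed.

Lemma circumcircle_exists (X Y Z : point) :
  det X Y Z <> 0 -> exists (r : R) (O : point), is_circumcircle O r X Y Z.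
Proof.
  destruct X as [x1 x2], Y as [y1 y2], Z as [z1 z2].
  unfold det; simpl. intros Hdet.
  set (p := (y1 - x1) * (y1 - x1) + (y2 - x2) * (y2 - x2)).
  set (q := (z1 - x1) * (z1 - x1) + (z2 - x2) * (z2 - x2)).
  set (d := (y1 - x1) * (z2 - x2) - (y2 - x2) * (z1 - x1)) in *.
  (* The circumcentre, as solved by Cramer's rule from the two bisector equations. *)
  set (O := (x1 + (p * (z2 - x2) - q * (y2 - x2)) / (2 * d),
             x2 + (q * (y1 - x1) - p * (z1 - x1)) / (2 * d))).
  exists (dist O (x1, x2)), O.
  split; [reflexivity|].
  split; (apply Rsqr_inj; [apply dist_nonneg | apply dist_nonneg |]);
    rewrite !dist_sqr; unfold O, Rsqr, p, q, d in *; simpl; field; exact Hdet.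
Qed.

(** Existence makes the value chosen by [epsilon] the radius of an actual circumcircle, and
    [circumcircle_radius] then determines it. *)
Lemma circumradius_formula (X Y Z : point) :
  det X Y Z <> 0 ->
  circumradius X Y Z = dist X Y * dist Y Z * dist Z X / (2 * Rabs (det X Y Z)).
Proof.
  intros Hdet.
  assert (Hc : exists O, is_circumcircle O (circumradius X Y Z) X Y Z)
    by exact (epsilon_spec (inhabits 0) _ (circumcircle_exists X Y Z Hdet)).
  destruct Hc as [O HO].
  rewrite <- (circumcircle_radius _ _ _ _ _ HO).
  field. now apply Rabs_no_R0.
Qed.

(** For [D = affine t B C], both [BD] and [det P B D] scale by [t], while [DC] and [det P D C] scale
    by [1 - t]. These factors cancel in the radius formula, so the radii are [PB] and [PC] times the
    same quantity [BC * PD / (2 |det P B C|)]. *)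
Lemma circumradius_split_side (P B C : point) (t : R) :
  det P B C <> 0 -> 0 < t < 1 ->
  circumradius P B (affine t B C) * dist P C =
  circumradius P (affine t B C) C * dist P B.
Proof.
  intros Hdet Ht.
  assert (E1 : det P B (affine t B C) = t * det P B C)
    by (unfold det, affine; simpl; ring).
  assert (E2 : det P (affine t B C) C = (1 - t) * det P B C)
    by (unfold det, affine; simpl; ring).
  rewrite !circumradius_formula;
    [| rewrite E2; apply Rmult_integral_contrapositive; split; lra
     | rewrite E1; apply Rmult_integral_contrapositive; split; lra].
  rewrite E1, E2, !Rabs_mult, dist_affine_l, dist_affine_r.
  rewrite (dist_sym C P), (dist_sym (affine t B C) P).
  rewrite (Rabs_pos_eq t), (Rabs_pos_eq (1 - t)) by lra.
  field. repeat split; try lra. now apply Rabs_no_R0.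
Qed.

Lemma in_interior_det (A B C P : point) :
  in_interior A B C P -> det A B C <> 0 ->
  det P B C <> 0 /\ det P C A <> 0 /\ det P A B <> 0.
Proof.
  intros (a & b & c & Ha & Hb & Hc & Hs & ->) Hdet.
  (* Eliminating [a] builds the constraint [a + b + c = 1] into the identities that [ring]
     checks. *)
  assert (Ea : a = 1 - b - c) by lra.
  match goal with |- det ?P _ _ <> 0 /\ _ =>
    assert (E1 : det P B C = a * det A B C)
      by (rewrite Ea; unfold det; simpl; ring);
    assert (E2 : det P C A = b * det A B C)
      by (rewrite Ea; unfold det; simpl; ring);
    assert (E3 : det P A B = c * det A B C)
      by (rewrite Ea; unfold det; simpl; ring)
  end.
  rewrite E1, E2, E3.
  repeat split; apply Rmult_integral_contrapositive; split; lra.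
Qed.

Lemma circumradius_cevian (A B C P D : point) :
  det P B C <> 0 -> det P C A <> 0 -> det P A B <> 0 ->
  on_line A P D /\ on_segment B C D ->
  circumradius P B D * dist P C = circumradius P D C * dist P B.
Proof.
  intros HA HB HC [[s Hs] [t [Ht ->]]].
  apply circumradius_split_side; [exact HA|].
  (* [D] lies on [AP], so [det P A D = 0]; expanding this along [BC] shows that [t = 0] would put
     [P] on line [AB] and [t = 1] would put it on line [CA]. *)
  assert (Hcol : (1 - t) * det P A B = t * det P C A).
  { assert (E : det P A (affine t B C) = 0)
      by (rewrite Hs; unfold det, affine; simpl; ring).
    apply Rminus_diag_uniq. rewrite <- E. unfold det, affine; simpl; ring. }
  assert (t <> 0) by (intros ->; apply HC; lra).
  assert (t <> 1) by (intros ->; apply HB; lra).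
  lra.
Qed.

Theorem theorem2p1 (A B C P D E F : point)
  (hABC : nondegenerate A B C)
  (hP : in_interior A B C P)
  (hD : on_line A P D /\ on_segment B C D)
  (hE : on_line B P E /\ on_segment C A E)
  (hF : on_line C P F /\ on_segment A B F) :
  circumradius P B D * circumradius P C E * circumradius P A F =
  circumradius P D C * circumradius P E A * circumradius P F B.
Proof.
  destruct (in_interior_det A B C P hP (det_nondegenerate A B C hABC))
    as (HA & HB & HC).
  pose proof (circumradius_cevian A B C P D HA HB HC hD) as H1.
  pose proof (circumradius_cevian B C A P E HB HC HA hE) as H2.
  pose proof (circumradius_cevian C A B P F HC HA HB hF) as H3.
  pose proof (dist_neq_0_of_det _ _ _ HA) as NB.
  pose proof (dist_neq_0_of_det _ _ _ HB) as NC.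
  pose proof (dist_neq_0_of_det _ _ _ HC) as NA.
  apply (Rmult_eq_reg_r (dist P A * dist P B * dist P C));
    [| repeat apply Rmult_integral_contrapositive_currified; assumption].
  (* Each radius is paired with the distance that its cevian identity exchanges. *)
  transitivity ((circumradius P B D * dist P C) * (circumradius P C E * dist P A)
                * (circumradius P A F * dist P B)); [ring|].
  rewrite H1, H2, H3. ring.
Qed.
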